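(* There exists a Robinson space $(S,\rho)$ with $|S|=6$ such that, for every real tree $(T,d)$, there is no valid drawing $I:S\to T$ of $(S,\rho)$.
   Context: A dissimilarity on a finite set $S$ is a function $\rho:S\times S\to\mathbb{R}_{\ge 0}$ with $\rho(x,y)=\rho(y,x)$ for all $x,y$, and $\rho(x,y)=0$ if and only if $x=y$; $(S,\rho)$ is then called a dissimilarity space. A dissimilarity space $(S,\rho)$ is Robinson if there is a total order $<$ on $S$ (a compatible order) such that $\rho(x,z)\ge\max\{\rho(x,y),\rho(y,z)\}$ for all $x<y<z$ in $S$. A valid drawing of $(S,\rho)$ in a metric space $(\mathcal{X},d)$ is an injection $I:S\to\mathcal{X}$ such that for all $x,y,z\in S$ with $\rho(x,y)<\rho(x,z)$ one has $d(I(x),I(y))<d(I(x),I(z))$. A real tree is a geodesic metric space $(T,d)$ without cycles: any two points $x,y\in T$ are joined by a unique arc (injective path up to reparametrization), and this arc is isometric to the interval $[0,d(x,y)]$. (In particular, for all $x,y,z\in T$ the three geodesics between the pairs have a common point.) *)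

(* Defs.v *)
From HB Require Import structures.
From mathcomp Require Import all_boot all_order all_algebra.
From mathcomp Require Import all_classical all_reals all_analysis.

Set Implicit Arguments.
Unset Strict Implicit.
Unset Printing Implicit Defensive.

Import Order.TTheory GRing.Theory Num.Theory.
Import numFieldNormedType.Exports.

Local Open Scope classical_set_scope.
Local Open Scope ring_scope.

Section Robinson.
Context {R : realType} {S : finType}.
Implicit Types (rho : S -> S -> R) (lt : rel S).

Definition dissimilarity rho : Prop :=
  [/\ forall x y, 0 <= rho x y,
      forall x y, rho x y = rho y x
    & forall x y, rho x y = 0 <-> x = y].

Definition strict_total_order lt : Prop :=
  [/\ irreflexive lt, transitive lt
    & forall x y, x != y -> lt x y || lt y x].

Definition compatible_order rho lt : Prop :=
  strict_total_order lt /\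
  forall x y z, lt x y -> lt y z -> Num.max (rho x y) (rho y z) <= rho x z.

Definition robinson_space rho : Prop :=
  dissimilarity rho /\ exists lt, compatible_order rho lt.

Definition valid_drawing (T : metricType R) rho (I : S -> T) : Prop :=
  injective I /\
  forall x y z, rho x y < rho x z -> mdist (I x) (I y) < mdist (I x) (I z).

End Robinson.

Section RealTree.
Context {R : realType} {T : metricType R}.
Implicit Types (x y : T) (l : R) (g h : R -> T).

(* Paths are functions on R of which only the restriction to [0, l] matters.
   The length l of the parameter interval is not fixed to 1 so that the arc
   from a point to itself exists: injectivity forces l = 0 when x = y. *)
Definition is_arc x y l g : Prop :=
  [/\ 0 <= l, {within `[0, l], continuous g},
      {in `[0, l] &, injective g}, g 0 = x & g l = y].

(* phi is an increasing homeomorphism from [0, l] onto [0, l']. *)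
Definition same_up_to_reparametrization l g l' g' : Prop :=
  exists phi : R -> R,
    [/\ {within `[0, l], continuous phi},
        {in `[0, l] &, {homo phi : s t / s < t}},
        phi 0 = 0, phi l = l'
      & {in `[0, l], forall t, g t = g' (phi t)}].

Definition isometric_on l h : Prop :=
  {in `[0, l] &, forall s t, mdist (h s) (h t) = `|s - t|}.

Definition geodesic x y h : Prop :=
  [/\ isometric_on (mdist x y) h, h 0 = x & h (mdist x y) = y].

End RealTree.

Record real_tree {R : realType} (T : metricType R) : Prop := {
  real_tree_geodesic : forall x y : T, exists h : R -> T, geodesic x y h;
  real_tree_arc : forall x y : T, exists l (g : R -> T), is_arc x y l g;
  real_tree_arc_unique : forall (x y : T) l (g : R -> T) l' (g' : R -> T),
    is_arc x y l g -> is_arc x y l' g' -> same_up_to_reparametrization l g l' g';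
  real_tree_arc_isometric : forall (x y : T) l (g : R -> T), is_arc x y l g ->
    exists h : R -> T, isometric_on (mdist x y) h /\
      h @` `[0, mdist x y] = g @` `[0, l] }.

(* Main.v *)
(* Real trees satisfy the four-point condition
     d(x,z) + d(w,y) <= max (d(x,y) + d(w,z)) (d(y,z) + d(w,x)):
   geodesics issued from w agree exactly up to a branching parameter, and this
   parameter is the Gromov product of their endpoints, because following one
   geodesic back to the branching point and then the other one forward gives an
   arc, and arcs are geodesics.

   In a valid drawing of the dissimilarity [dissim6], with d_ij the distance
   between the images of i and j,
     d03 > d35 > d45 > d14 > d24 > d02, d04 > d45, d24 > d34,
     d12 > d01 and d12 > d23.
   Since d03 > d02 and d24 > d34, the four-point condition for 0, 2, 3, 4 gives
   d03 + d24 <= d04 + d23; since d04 > d24 and d12 > d01, the one for 0, 1, 2, 4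
   gives d04 + d12 <= d02 + d14. The sum of these two inequalities contradicts
   d03 > d14, d24 > d02 and d12 > d23. *)
Require Import Defs.
From mathcomp Require Import all_boot all_order all_algebra.
From mathcomp Require Import all_classical all_reals all_analysis.
From mathcomp Require Import lra.

Set Implicit Arguments.
Unset Strict Implicit.
Unset Printing Implicit Defensive.

Import Order.TTheory GRing.Theory Num.Theory.

Local Open Scope classical_set_scope.
Local Open Scope ring_scope.

Section Geodesics.
Context {R : realType} {T : metricType R}.
Implicit Types (x y z w : T) (g h : R -> T) (l s t : R).

(** The 1-Lipschitz bound also covers a concatenation of two geodesics, before it is known to be
    isometric. *)
Lemma lipschitz1_within_continuous l g :
  {in `[0, l] &, forall s t, mdist (g s) (g t) <= `|s - t|} ->
  {within `[0, l], continuous g}.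
Proof.
move=> gL; apply/subspace_continuousP => s sl; apply/cvg_ballP => e e0.
rewrite near_withinE; near=> t => tl.
rewrite ballEmdist /=; apply: (le_lt_trans (gL _ _ sl tl)).
by near: t; exact: (@cvgr_dist_lt _ _ _ _ _ id s).
Unshelve. all: by end_near. Qed.

Lemma isometric_on_arc l g :
  0 <= l -> isometric_on l g -> is_arc (g 0) (g l) l g.
Proof.
move=> l0 gi; split => //.
  by apply: lipschitz1_within_continuous => s t sl tl; rewrite gi.
move=> s t sl tl gst; apply/eqP; rewrite -subr_eq0 -normr_eq0.
by rewrite -gi// gst mdistxx.
Qed.

Lemma geodesic_arc x y g : geodesic x y g -> is_arc x y (mdist x y) g.
Proof.
move=> [gi g0 g1]; have := isometric_on_arc (mdist_ge0 x y) gi.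
by rewrite g0 g1.
Qed.

Lemma geodesic_dist x y g s t : geodesic x y g ->
  0 <= s -> s <= t -> t <= mdist x y -> mdist (g s) (g t) = t - s.
Proof.
move=> [gi _ _] s0 st td.
rewrite gi ?in_itv/= ?s0 ?(le_trans st)//; last by rewrite (le_trans s0).
by rewrite distrC ger0_norm// subr_ge0.
Qed.

Lemma geodesic_distl x y g s : geodesic x y g ->
  0 <= s -> s <= mdist x y -> mdist x (g s) = s.
Proof.
move=> gg s0 sd; have [_ g0 _] := gg.
by rewrite -{1}g0 (geodesic_dist gg)// subr0.
Qed.

Lemma geodesic_distr x y g s : geodesic x y g ->
  0 <= s -> s <= mdist x y -> mdist (g s) y = mdist x y - s.
Proof.
move=> gg s0 sd; have [_ _ g1] := gg.
by rewrite -{1}g1 (geodesic_dist gg).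
Qed.

Lemma geodesic_initial x y g s : geodesic x y g ->
  0 <= s -> s <= mdist x y -> geodesic x (g s) g.
Proof.
move=> gg s0 sd; have [gi g0 _] := gg.
have ds := geodesic_distl gg s0 sd.
split => //; rewrite ds// => t u; rewrite !in_itv/= => /andP[t0 ts] /andP[u0 us].
by rewrite gi// in_itv/= ?t0 ?u0/= (le_trans _ sd).
Qed.

Hypothesis treeT : real_tree T.

(** Uniqueness of arcs gives [g t = h (phi t)]. Both sides are parametrized by the distance to [x],
    so [phi t = t]. *)
Lemma geodesic_unique x y g h : geodesic x y g -> geodesic x y h ->
  {in `[0, mdist x y], g =1 h}.
Proof.
move=> gg gh.
have [phi [_ phi_incr phi0 phi1 gphi]] :=
  real_tree_arc_unique treeT (geodesic_arc gg) (geodesic_arc gh).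
have phi_homo : {in `[0, mdist x y] &, {homo phi : s t / s <= t}}.
  by move=> s t sd td; rewrite le_eqVlt => /predU1P[->//|/(phi_incr _ _ sd td)/ltW].
move=> t td; rewrite gphi//; congr h.
have := td; rewrite in_itv/= => /andP[t0 t1].
have p0 : 0 <= phi t by rewrite -phi0 phi_homo// in_itv/= lexx mdist_ge0.
have p1 : phi t <= mdist x y.
  by rewrite -phi1 phi_homo// in_itv/= lexx mdist_ge0.
by rewrite -[LHS](geodesic_distl gh)// -gphi// (geodesic_distl gg).
Qed.

Lemma geodesic_agree x y z g h s t : geodesic x y g -> geodesic x z h ->
  0 <= t <= s -> s <= mdist x y -> s <= mdist x z -> g s = h s -> g t = h t.
Proof.
move=> gg gh /andP[t0 ts] sy sz gs.
have s0 := le_trans t0 ts.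
have gg' := geodesic_initial gg s0 sy.
have gh' : geodesic x (g s) h by rewrite gs; exact: geodesic_initial gh s0 sz.
by apply: (geodesic_unique gg' gh'); rewrite (geodesic_distl gg)// in_itv/= t0.
Qed.

Lemma last_agreement x y z g h : geodesic x y g -> geodesic x z h ->
  exists s, [/\ 0 <= s, s <= mdist x y, s <= mdist x z, g s = h s &
    forall t, s < t -> t <= mdist x y -> t <= mdist x z -> g t <> h t].
Proof.
move=> gg gh.
pose A : set R := [set t | [/\ 0 <= t, t <= mdist x y, t <= mdist x z & g t = h t]].
have A0 : A 0.
  have [_ g0 _] := gg; have [_ h0 _] := gh.
  by rewrite /A/= g0 h0 !mdist_ge0.
have supA : has_sup A.
  by split; [exists 0 | exists (mdist x y) => t [_ ]].
have ubA := sup_upper_bound supA.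
have s0 : 0 <= sup A by exact: ubA.
have sy : sup A <= mdist x y by apply: sup_le_ub => [|t []//]; exists 0.
have sz : sup A <= mdist x z by apply: sup_le_ub => [|t []//]; exists 0.
exists (sup A); split => //.
  (* The supremum is attained: an agreement within half the gap below it would, by the triangle
     inequality, make the gap smaller than itself. *)
  apply: contrapT => /eqP; rewrite -mdist_gt0 => e0.
  have e20 : 0 < mdist (g (sup A)) (h (sup A)) / 2 by lra.
  have [t At tA] := sup_adherent e20 supA.
  have ts := ubA _ At; case: At => t0 ty tz gt.
  have := metric_triangle (g (sup A)) (g t) (h (sup A)).
  by rewrite (metric_sym _ (g t)) (geodesic_dist gg)// gt (geodesic_dist gh)//; lra.
move=> t st ty tz gt.
have /ubA : A t by split => //; lra.
lra.
Qed.

Lemma geodesic_branching x y z g h : geodesic x y g -> geodesic x z h ->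
  exists s, [/\ 0 <= s, s <= mdist x y, s <= mdist x z, g s = h s &
    mdist y z = mdist x y + mdist x z - 2 * s].
Proof.
move=> gg gh.
have [s [s0 sy sz gs gNh]] := last_agreement gg gh.
exists s; split => //.
set a := mdist x y in sy gNh *; set b := mdist x z in sz gNh *.
pose l := (a - s) + (b - s).
(* Back along [g] from [y] to the branching point, reached at [a - s], then forward along [h] to
   [z]. *)
pose k t := if t <= a - s then g (a - t) else h (t - (a - s) + s).
have kL : {in `[0, l] &, forall t u, mdist (k t) (k u) <= `|t - u|}.
  move=> t u; wlog tu : t u / t <= u.
    by move=> W tl ul; have [/W|/ltW/W] := leP t u;
      rewrite 1?metric_sym 1?distrC; exact.
  rewrite !in_itv/= => /andP[t0 tl] /andP[u0 ul].
  rewrite distrC ger0_norm ?subr_ge0// /k /l in tl ul *.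
  have [tm|tm] := leP t (a - s); have [um|um] := leP u (a - s); last 1 first.
  - by rewrite (geodesic_dist gh) -/b; lra.
  - by rewrite metric_sym (geodesic_dist gg) -/a; lra.
  - apply: le_trans (metric_triangle _ (g s) _) _.
    rewrite (metric_sym _ (g s)) (geodesic_dist gg) -/a; [|lra..].
    by rewrite gs (geodesic_dist gh) -/b; lra.
  - lra.
have kinj : {in `[0, l] &, injective k}.
  move=> t u; wlog tu : t u / t <= u.
    move=> W tl ul; have [tu|/ltW tu] := leP t u; first exact: W.
    by move=> /esym kut; apply/esym/W.
  rewrite !in_itv/= => /andP[t0 tl] /andP[u0 ul].
  rewrite /k /l in tl ul *.
  have [tm|tm] := leP t (a - s); have [um|um] := leP u (a - s) => ktu; last 1 first.
  - have : mdist (h (t - (a - s) + s)) (h (u - (a - s) + s)) = 0 by rewrite ktu mdistxx.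
    by rewrite (geodesic_dist gh) -/b; lra.
  - have : mdist (g (a - u)) (g (a - t)) = 0 by rewrite ktu mdistxx.
    by rewrite (geodesic_dist gg) -/a; lra.
  (* A point common to both legs has the same distance to [x] on each, so [g] and [h] would agree at
     [a - t], beyond the last agreement [s]. *)
  - have E : mdist x (g (a - t)) = mdist x (h (u - (a - s) + s)) by rewrite ktu.
    rewrite (geodesic_distl gg) -/a in E; [|lra..].
    rewrite (geodesic_distl gh) -/b in E; [|lra..].
    exfalso; apply: (gNh (a - t)); [lra..|].
    by rewrite {2}E.
  - lra.
have k0 : k 0 = y by have [_ _ gy] := gg; rewrite /k subr0 ifT// subr_ge0.
have kl : k l = z.
  have [_ _ hz] := gh; rewrite /k /l; case: ifPn => [lm|_].
    (* Here the second leg is reduced to a point, and [k l] falls in the first branch. *)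
    have sb : s = b by lra.
    by rewrite -hz -/b -sb -gs; congr g; lra.
  by rewrite -hz -/b; congr h; lra.
have karc : is_arc y z l k.
  by split => //; [rewrite /l; lra|exact: lipschitz1_within_continuous].
have [f gf] := real_tree_geodesic treeT y z.
have [phi [_ phi_incr phi0 phi1 kphi]] :=
  real_tree_arc_unique treeT karc (geodesic_arc gf).
have phi_homo : {in `[0, l] &, {homo phi : s t / s <= t}}.
  by move=> t u tl ul; rewrite le_eqVlt => /predU1P[->//|/(phi_incr _ _ tl ul)/ltW].
have ml : a - s \in `[0, l] by rewrite in_itv/= /l; lra.
have p0 : 0 <= phi (a - s) by rewrite -phi0 phi_homo// ?in_itv/= /l; lra.
have p1 : phi (a - s) <= mdist y z.
  by rewrite -phi1 phi_homo// ?in_itv/= /l; lra.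
(* The geodesic [f] from [y] to [z] thus passes through [g s], so the distances from [g s] to [y]
   and to [z] add up to that from [y] to [z]. *)
have := kphi _ ml; rewrite /k lexx subKr => gf'.
have := geodesic_distl gf p0 p1; have := geodesic_distr gf p0 p1.
rewrite -gf' (metric_sym y (g s)) {1}gs (geodesic_distr gh)// (geodesic_distr gg)// -/a -/b.
lra.
Qed.

(** With Gromov products based at [w], this reads (x|z) >= min((x|y), (y|z)): the geodesics from [w]
    to [x] and to [z] both follow the one to [y] up to that minimum. *)
Lemma four_point x y z w :
  mdist x z + mdist w y <=
    Num.max (mdist x y + mdist w z) (mdist y z + mdist w x).
Proof.
have [g gg] := real_tree_geodesic treeT w x.
have [h gh] := real_tree_geodesic treeT w y.
have [k gk] := real_tree_geodesic treeT w z.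
have [s [s0 sx sy gs ->]] := geodesic_branching gg gh.
have [t [t0 ty tz gt ->]] := geodesic_branching gh gk.
have dxz u : 0 <= u -> u <= mdist w x -> u <= mdist w z -> g u = k u ->
    mdist x z <= mdist w x + mdist w z - 2 * u.
  move=> u0 ux uz gu; apply: le_trans (metric_triangle _ (g u) _) _.
  by rewrite (metric_sym x) (geodesic_distr gg)// gu (geodesic_distr gk)//; lra.
rewrite le_max; apply/orP; have [st|/ltW ts] := leP s t; [left|right].
  have sk : h s = k s by apply: (geodesic_agree gh gk _ ty); rewrite ?s0.
  have := dxz s s0 sx (le_trans st tz); rewrite gs => /(_ sk).
  lra.
have gk' : g t = h t by apply: (geodesic_agree gg gh _ sx); rewrite ?t0.
have := dxz t t0 (le_trans ts sx) tz; rewrite gk' => /(_ gt).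
lra.
Qed.

End Geodesics.

(** In each row the entries weakly increase away from the diagonal, which makes the natural order
    compatible. *)
Definition dissim6_row (i : nat) : seq nat := nth [::]
  [:: [:: 0; 1; 2; 7; 7; 7];
      [:: 1; 0; 2; 2; 4; 6];
      [:: 2; 2; 0; 1; 3; 6];
      [:: 7; 2; 1; 0; 1; 6];
      [:: 7; 4; 3; 1; 0; 5];
      [:: 7; 6; 6; 6; 5; 0]] i.

Definition dissim6 (i j : 'I_6) : nat := nth 0 (dissim6_row i) j.

Theorem theorem15 (R : realType) :
  exists (S : finType) (rho : S -> S -> R),
    [/\ #|S| = 6, robinson_space rho
      & forall T : metricType R, real_tree T ->
          ~ exists I : S -> T, valid_drawing rho I].
Proof.
pose rho (i j : 'I_6) : R := (dissim6 i j)%:R.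
exists 'I_6, rho; split; first by rewrite card_ord.
  split.
    split => [i j|i j|i j]; first exact: ler0n.
      by congr _%:R; case: i j => [[|[|[|[|[|[|?]]]]]] ?] [[|[|[|[|[|[|?]]]]]] ?].
    split => [/eqP|->]; last by case: j => [[|[|[|[|[|[|?]]]]]] ?].
    by rewrite pnatr_eq0 => ij; apply/val_inj; move: ij;
      case: i j => [[|[|[|[|[|[|?]]]]]] ?] [[|[|[|[|[|[|?]]]]]] ?].
  exists (fun i j : 'I_6 => (i < j)%N); split.
    split => [i|j i k|i j]; [exact: ltnn|exact: ltn_trans|].
    by rewrite -neq_ltn.
  move=> i j k; rewrite ge_max !ler_nat.
  by case: i j k => [[|[|[|[|[|[|?]]]]]] ?] [[|[|[|[|[|[|?]]]]]] ?] [[|[|[|[|[|[|?]]]]]] ?].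
move=> T treeT [I [_ Ilt]].
have lt_dist (i j k : 'I_6) : (dissim6 i j < dissim6 i k)%N ->
    mdist (I i) (I j) < mdist (I i) (I k).
  by move=> ijk; apply: Ilt; rewrite ltr_nat.
(* Indexing by [nat] lets the comparisons of entries be decided by computation and makes each
   [d i j] an atom for [lra]. *)
pose p : nat -> 'I_6 := inord.
pose d i j := mdist (I (p i)) (I (p j)).
have dC i j : d i j = d j i by exact: metric_sym.
have lt_d i j k : (i < 6)%N -> (j < 6)%N -> (k < 6)%N ->
    (nth 0 (dissim6_row i) j < nth 0 (dissim6_row i) k)%N -> d i j < d i k.
  by move=> i6 j6 k6 ijk; apply: lt_dist; rewrite /dissim6 !inordK.
have d01_12 : d 1 0 < d 1 2 by exact: lt_d.
have d23_12 : d 2 3 < d 2 1 by exact: lt_d.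
have d02_24 : d 2 0 < d 2 4 by exact: lt_d.
have d34_24 : d 4 3 < d 4 2 by exact: lt_d.
have d24_14 : d 4 2 < d 4 1 by exact: lt_d.
have d14_45 : d 4 1 < d 4 5 by exact: lt_d.
have d45_04 : d 4 5 < d 4 0 by exact: lt_d.
have d45_35 : d 5 4 < d 5 3 by exact: lt_d.
have d35_03 : d 3 5 < d 3 0 by exact: lt_d.
have := four_point treeT (I (p 0)) (I (p 2)) (I (p 4)) (I (p 1)).
have := four_point treeT (I (p 0)) (I (p 4)) (I (p 3)) (I (p 2)).
rewrite -!/(d _ _) !le_max.
rewrite ?(dC 1 0) ?(dC 2 0) ?(dC 3 0) ?(dC 4 0) ?(dC 2 1) ?(dC 4 1) ?(dC 3 2)
  ?(dC 4 2) ?(dC 4 3) ?(dC 5 3) ?(dC 5 4) in d01_12 d23_12 d02_24 d34_24 d24_14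
  d14_45 d45_04 d45_35 d35_03 *.
(* Only the choice of the first term in both maxima needs the sum of the two inequalities; a second
   term is refuted by termwise comparison. *)
by move=> /orP[] ? /orP[] ?; lra.
Qed.
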